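(* For indeterminates $t,u,x_1,\dots,x_{2n}$, $$\sum_{\lambda}\prod_{i=1}^{n}(1-ut^{\lambda_{2i}-2i+2n})\,s_\lambda(x_1,\dots,x_{2n})=\prod_{1\le i<j\le 2n}\frac{1}{x_i-x_j}\ \mathop{\rm Pf}_{1\le i<j\le 2n}\left[\frac{(x_i-x_j)(1-u+(u-t)x_ix_j)}{(1-x_ix_j)(1-tx_ix_j)}\right],$$ where the sum runs over all partitions $\lambda$ of length at most $2n$ whose conjugate $\lambda'$ has only even parts (all columns of even length).
   Context: $s_\lambda$ is the Schur polynomial; $\lambda$ is regarded as $(\lambda_1,\dots,\lambda_{2n})$ padded with zeros. $\mathop{\rm Pf}_{1\le i<j\le 2n}[a_{ij}]$ is the Pfaffian of the antisymmetric matrix with upper-triangular entries $a_{ij}$. Identity of formal power series. *)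

(* Defs.v *)
From HB Require Import structures.
From mathcomp Require Import all_boot all_order all_fingroup all_algebra.
From mathcomp Require Import boolp mpoly.

Set Implicit Arguments.
Unset Strict Implicit.
Unset Printing Implicit Defensive.

Import GRing.Theory.

Local Open Scope ring_scope.

Record fps (n : nat) (R : nzRingType) := Fps { fcoef : 'X_{1..n} -> R }.

Notation "{ 'fps' R [ n ] }" := (fps n R)
  (at level 0, R at level 2, n at level 2, format "{ 'fps'  R [ n ] }").

HB.instance Definition _ n R := [isNew for @fcoef n R].
HB.instance Definition _ n (R : nzRingType) := [Choice of {fps R[n]} by <:].

Section FpsRing.
Variables (n : nat).

Section Base.
Variable R : nzRingType.
Implicit Types (f g h : {fps R[n]}) (p q : {mpoly R[n]}) (m : 'X_{1..n}).

Lemma fpsP f g : (forall m, fcoef f m = fcoef g m) -> f = g.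
Proof. by case: f g => [f] [g] /= fg; congr Fps; apply/funext. Qed.

Definition fps_of_mpoly p : {fps R[n]} := Fps (fun m => p@_m).

Definition fps_add f g := Fps (fun m => fcoef f m + fcoef g m).
Definition fps_opp f := Fps (fun m => - fcoef f m).

(* Cauchy product; the indices are the pairs (m1, m2) with m1 + m2 = m.       *)
Definition fps_mul f g :=
  Fps (fun m => \sum_(k : 'X_{1..n < (mdeg m).+1, (mdeg m).+1} |
                      m == (k.1 + k.2)%MM) fcoef f k.1 * fcoef g k.2).

Lemma fps_addA : associative fps_add.
Proof. by move=> f g h; apply: fpsP => m /=; rewrite addrA. Qed.

Lemma fps_addC : commutative fps_add.
Proof. by move=> f g; apply: fpsP => m /=; rewrite addrC. Qed.

Lemma fps_add0 : left_id (fps_of_mpoly 0) fps_add.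
Proof. by move=> f; apply: fpsP => m /=; rewrite mcoeff0 add0r. Qed.

Lemma fps_addN : left_inverse (fps_of_mpoly 0) fps_opp fps_add.
Proof. by move=> f; apply: fpsP => m /=; rewrite mcoeff0 addNr. Qed.

HB.instance Definition _ := GRing.isZmodule.Build {fps R[n]}
  fps_addA fps_addC fps_add0 fps_addN.

Lemma fcoef0 m : fcoef (0 : {fps R[n]}) m = 0.
Proof. exact: mcoeff0. Qed.

Definition fps_trunc k f : {mpoly R[n]} :=
  \sum_(m : 'X_{1..n < k}) fcoef f m *: 'X_[m].

Lemma mcoeff_trunc k f m : (mdeg m < k)%N -> (fps_trunc k f)@_m = fcoef f m.
Proof. exact: mcoeff_mpoly. Qed.

Lemma mcoeffM_low k p1 p2 q1 q2 m : (mdeg m < k)%N ->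
  (forall m', (mdeg m' < k)%N -> p1@_m' = p2@_m') ->
  (forall m', (mdeg m' < k)%N -> q1@_m' = q2@_m') ->
  (p1 * q1)@_m = (p2 * q2)@_m.
Proof.
move=> mk p12 q12; rewrite !mcoeffM; apply: eq_bigr => -[k1 k2] /= _.
by rewrite p12 ?q12 // (leq_trans (bmdeg _)).
Qed.

Lemma fcoefM_trunc k f g m : (mdeg m < k)%N ->
  fcoef (fps_mul f g) m = (fps_trunc k f * fps_trunc k g)@_m.
Proof.
move=> mk; rewrite mcoeffM /=; apply: eq_bigr => -[k1 k2] /= _.
by rewrite !mcoeff_trunc // (leq_trans (bmdeg _)).
Qed.

Lemma fps_mulA : associative fps_mul.
Proof.
move=> f g h; apply: fpsP => m; have mk := ltnSn (mdeg m).
rewrite !(fcoefM_trunc _ _ mk).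
set T := fps_trunc _.
transitivity ((T f * T g * T h)@_m).
  rewrite -mulrA; apply: (mcoeffM_low mk) => // m' m'k.
  by rewrite /T mcoeff_trunc // (fcoefM_trunc _ _ m'k).
apply: (mcoeffM_low mk) => // m' m'k.
by rewrite /T mcoeff_trunc // (fcoefM_trunc _ _ m'k).
Qed.

Lemma trunc_mpoly k p m : (mdeg m < k)%N -> (fps_trunc k (fps_of_mpoly p))@_m = p@_m.
Proof. by move=> mk; rewrite mcoeff_trunc. Qed.

Lemma fps_mul1f : left_id (fps_of_mpoly 1) fps_mul.
Proof.
move=> f; apply: fpsP => m; have mk := ltnSn (mdeg m).
rewrite (fcoefM_trunc _ _ mk) -[RHS](mcoeff_trunc f mk) -[in RHS](mul1r (fps_trunc _ f)).
by apply: (mcoeffM_low mk) => // m' m'k; rewrite trunc_mpoly.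
Qed.

Lemma fps_mulf1 : right_id (fps_of_mpoly 1) fps_mul.
Proof.
move=> f; apply: fpsP => m; have mk := ltnSn (mdeg m).
rewrite (fcoefM_trunc _ _ mk) -[RHS](mcoeff_trunc f mk) -[in RHS](mulr1 (fps_trunc _ f)).
by apply: (mcoeffM_low mk) => // m' m'k; rewrite trunc_mpoly.
Qed.

Lemma fps_mulDl : left_distributive fps_mul +%R.
Proof.
move=> f g h; apply: fpsP => m /=; rewrite -big_split /=.
by apply: eq_bigr => k _; rewrite mulrDl.
Qed.

Lemma fps_mulDr : right_distributive fps_mul +%R.
Proof.
move=> f g h; apply: fpsP => m /=; rewrite -big_split /=.
by apply: eq_bigr => k _; rewrite mulrDr.
Qed.

Lemma fps_oner_neq0 : fps_of_mpoly 1 != 0.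
Proof.
apply/eqP => /(congr1 (fun f => fcoef f 0%MM)) /=.
by rewrite mcoeff1 mcoeff0 eqxx => /eqP; rewrite oner_eq0.
Qed.

HB.instance Definition _ := GRing.Zmodule_isNzRing.Build {fps R[n]}
  fps_mulA fps_mul1f fps_mulf1 fps_mulDl fps_mulDr fps_oner_neq0.

Lemma fcoefM f g m : fcoef (f * g) m =
  \sum_(k : 'X_{1..n < (mdeg m).+1, (mdeg m).+1} |
        m == (k.1 + k.2)%MM) fcoef f k.1 * fcoef g k.2.
Proof. by []. Qed.

End Base.

Lemma fps_mulC (R : comNzRingType) : commutative (@fps_mul R).
Proof.
move=> f g; apply: fpsP => m; have mk := ltnSn (mdeg m).
by rewrite !(fcoefM_trunc _ _ mk) mulrC.
Qed.

HB.instance Definition _ (R : comNzRingType) :=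
  GRing.PzSemiRing_hasCommutativeMul.Build {fps R[n]} (@fps_mulC R).

Section Domain.
Variable R : idomainType.
Implicit Types (f g : {fps R[n]}).

Definition fps_unit : pred {fps R[n]} := fun f => `[< exists g, g * f = 1 >].

Definition fps_inv f : {fps R[n]} :=
  if pselect (exists g, g * f = 1) is left fU then sval (cid fU) else f.

Lemma fps_mulVr : {in fps_unit, left_inverse 1 fps_inv *%R}.
Proof.
move=> f /asboolP fU; rewrite /fps_inv; case: pselect => // fU'.
by case: cid.
Qed.

Lemma fps_unitP f g : g * f = 1 -> fps_unit f.
Proof. by move=> gf; apply/asboolP; exists g. Qed.

Lemma fps_inv_out : {in [predC fps_unit], fps_inv =1 id}.
Proof.
move=> f /asboolPn fU; rewrite /fps_inv; case: pselect => [fU'|//].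
by case: (fU fU').
Qed.

HB.instance Definition _ := GRing.ComNzRing_hasMulInverse.Build {fps R[n]}
  fps_mulVr fps_unitP fps_inv_out.

Definition fps_homog d f : {mpoly R[n]} :=
  \sum_(m : 'X_{1..n < d.+1}) (if mdeg m == d then fcoef f m else 0) *: 'X_[m].

Lemma mcoeff_homog d f m :
  (fps_homog d f)@_m = if mdeg m == d then fcoef f m else 0.
Proof.
have [mk|mk] := ltnP (mdeg m) d.+1.
  exact: (mcoeff_mpoly (fun m => if mdeg m == d then fcoef f m else 0)).
rewrite gtn_eqF // /fps_homog raddf_sum /= big1 // => i _.
rewrite mcoeffZ mcoeffX [_ == m]negbTE ?mulr0 //.
by apply: contraL mk => /eqP <-; rewrite -ltnNge bmdeg.
Qed.

Lemma fps_lowest f : f != 0 ->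
  exists2 d, fps_homog d f != 0 & forall m, (mdeg m < d)%N -> fcoef f m = 0.
Proof.
move=> f_neq0.
pose P d := `[< exists m, mdeg m = d /\ fcoef f m != 0 >].
have exP : exists d, P d.
  have [m fm] : exists m, fcoef f m != 0.
    apply: contrapT => nex; case/eqP: f_neq0; apply: fpsP => m.
    by rewrite fcoef0; apply/eqP/negPn/negP => fm; apply: nex; exists m.
  by exists (mdeg m); apply/asboolP; exists m.
case: (ex_minnP exP) => d /asboolP [m [md fm]] dmin; exists d => [|m' m'd].
  apply: contraNneq fm => /(congr1 (mcoeff m)).
  by rewrite mcoeff_homog md eqxx mcoeff0 => ->.
apply/eqP; apply: contraLR m'd => fm'; rewrite -leqNgt dmin //.
by apply/asboolP; exists m'.
Qed.

Lemma fps_idomainAxiom f g : f * g = 0 -> (f == 0) || (g == 0).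
Proof.
move=> fg0; apply/norP => -[/fps_lowest [d fd fmin] /fps_lowest [e ge gmin]].
suff: fps_homog d f * fps_homog e g == 0 by rewrite mulf_eq0 (negPf fd) (negPf ge).
apply/eqP/mpolyP => m; rewrite mcoeff0.
have [mde|mde] := eqVneq (mdeg m) (d + e)%N; last first.
  rewrite mcoeffM big1 // => -[k1 k2] /= /eqP mE; rewrite !mcoeff_homog.
  case: eqP => [k1d|]; last by rewrite mul0r.
  case: eqP => [k2e|]; last by rewrite mulr0.
  by case/eqP: mde; rewrite mE mdegD k1d k2e.
transitivity (fcoef (f * g) m); last by rewrite fg0 fcoef0.
rewrite mcoeffM fcoefM; apply: eq_bigr => -[k1 k2] /= /eqP mE.
rewrite !mcoeff_homog.
have kde : (mdeg k1 + mdeg k2 = d + e)%N by rewrite -mdegD -mE.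
case: (ltngtP (mdeg k1) d) => [k1d|k1d|k1d].
- by rewrite fmin // !mul0r.
- by rewrite (gmin k2) ?mulr0 ?mul0r // -(ltn_add2l d) -kde ltn_add2r.
- by move: kde; rewrite k1d => /addnI ->; rewrite eqxx.
Qed.

HB.instance Definition _ :=
  GRing.ComUnitRing_isIntegral.Build {fps R[n]} fps_idomainAxiom.

End Domain.
End FpsRing.

(* S is the sum of the family (F i), i ranging over P: each coefficient       *)
(* receives finitely many nonzero contributions, and these add up to that of  *)
(* S.                                                                         *)
Definition is_fps_sum n (R : nzRingType) (I : eqType) (P : pred I)
    (F : I -> {fps R[n]}) (S : {fps R[n]}) : Prop :=
  forall m : 'X_{1..n}, exists s : seq I,
    [/\ uniq s, all P s,
        forall i, P i -> i \notin s -> fcoef (F i) m = 0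
      & fcoef S m = \sum_(i <- s) fcoef (F i) m].

Lemma fps_sum_uniq n (R : nzRingType) (I : eqType) (P : pred I)
    (F : I -> {fps R[n]}) (S1 S2 : {fps R[n]}) :
  is_fps_sum P F S1 -> is_fps_sum P F S2 -> S1 = S2.
Proof.
move=> FS1 FS2; apply: fpsP => m.
have [s1 [s1U s1P s1F ->]] := FS1 m; have [s2 [s2U s2P s2F ->]] := FS2 m.
rewrite (bigID (mem s2)) [RHS](bigID (mem s1)) /=.
rewrite [X in _ + X]big_seq_cond [X in _ + X]big1 => [|i /andP [is1 is2]]; last first.
  by rewrite s2F // (allP s1P).
rewrite [X in _ = _ + X]big_seq_cond [X in _ = _ + X]big1; last first.
  by move=> i /andP [is2 is1]; rewrite s1F // (allP s2P).
congr (_ + 0); rewrite -big_filter -[RHS]big_filter; apply: perm_big.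
apply: uniq_perm; rewrite ?filter_uniq // => i.
by rewrite !mem_filter /= andbC.
Qed.

Definition is_partn (l : seq nat) : bool := sorted geq l && (0%N \notin l).

(* One-based, so that part l k is the k-th part, zero beyond the length.      *)
Definition part (l : seq nat) (k : nat) : nat := nth 0%N l k.-1.

Definition conj_partn (l : seq nat) : seq nat :=
  [seq count (fun p => j <= p)%N l | j <- iota 1 (head 0%N l)].

Lemma det_pow_dvd (A : comNzRingType) N (x : 'I_N -> A) (a : 'I_N -> nat) :
  exists q, q * \prod_(i < N) \prod_(j < N | (i < j)%N) (x i - x j) =
            \det (\matrix_(i < N, j < N) x i ^+ a j).
Proof.
pose P : {poly A} := \prod_(i < N) ('X - (x i)%:P).
have Pmonic : P \is monic by apply: monic_prod => i _; apply: monicXsubC.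
have sizeP : size P = N.+1 by rewrite /P -big_enum size_prod_XsubC size_enum_ord.
pose r (j : 'I_N) := Pdiv.Ring.rmodp 'X^(a j) P.
have size_r j : (size (r j) <= N)%N.
  by rewrite -ltnS -sizeP Pdiv.Ring.ltn_rmodpN0 // monic_neq0.
pose C : 'M[A]_N := \matrix_(k, j) (r j)`_k.
pose V : 'M[A]_N := Vandermonde N (\row_i x i).
have -> : (\matrix_(i < N, j < N) x i ^+ a j) = V^T *m C.
  apply/matrixP => i j; rewrite !mxE.
  have: ('X^(a j)).[x i] = (r j).[x i].
    rewrite [in LHS](Pdiv.RingMonic.rdivp_eq Pmonic 'X^(a j)) hornerD hornerM.
    by rewrite horner_prod (bigD1 i) //= hornerXsubC subrr mul0r mulr0 add0r.
  rewrite hornerXn => ->; rewrite (horner_coef_wide _ (size_r j)).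
  by apply: eq_bigr => k _; rewrite !mxE mulrC.
exists ((\prod_(i < N) \prod_(j < N | (i < j)%N) -1) * \det C).
rewrite det_mulmx det_tr det_Vandermonde mulrAC; congr (_ * _).
rewrite -big_split /=; apply: eq_bigr => i _.
by rewrite -big_split /=; apply: eq_bigr => j _; rewrite !mxE mulN1r opprB.
Qed.

Section Schur.
Variables (N : nat) (R : idomainType).

Definition alternant (a : 'I_N -> nat) : {mpoly R[N]} :=
  \det (\matrix_(i < N, j < N) 'X_i ^+ a j).

Definition vandermonde_prod : {mpoly R[N]} :=
  \prod_(i < N) \prod_(j < N | (i < j)%N) ('X_i - 'X_j).

Lemma alternant_dvd (a : 'I_N -> nat) :
  exists q : {mpoly R[N]}, q * vandermonde_prod == alternant a.
Proof.
have [q qE] := det_pow_dvd (fun i : 'I_N => 'X_i : {mpoly R[N]}) a.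
by exists q; apply/eqP.
Qed.

(* Exact quotient of alternants a_(l + delta) / a_delta with delta_j = N - j;  *)
(* it is unique because {mpoly R[N]} is an integral domain.                   *)
Definition schur (l : seq nat) : {mpoly R[N]} :=
  xchoose (alternant_dvd (fun j => part l j.+1 + (N - j.+1))%N).

Lemma schurE (l : seq nat) : schur l * vandermonde_prod =
  alternant (fun j => part l j.+1 + (N - j.+1))%N.
Proof. exact/eqP/(xchooseP (alternant_dvd _)). Qed.

End Schur.

Section Pfaffian.
Variable R : comNzRingType.

Definition antisym_mx m (a : 'I_m -> 'I_m -> R) : 'M[R]_m :=
  \matrix_(i, j) if (i < j)%N then a i j
                 else if (j < i)%N then - a j i else 0.

Variable n : nat.

Lemma even_ord_subproof (i : 'I_n) : (2 * i < 2 * n)%N.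
Proof. by rewrite ltn_pmul2l. Qed.

Lemma odd_ord_subproof (i : 'I_n) : ((2 * i).+1 < 2 * n)%N.
Proof. by rewrite !mul2n -doubleS ltn_Sdouble. Qed.

Definition even_ord (i : 'I_n) : 'I_(2 * n) := Ordinal (even_ord_subproof i).
Definition odd_ord (i : 'I_n) : 'I_(2 * n) := Ordinal (odd_ord_subproof i).

(* Each perfect matching of 'I_(2 * n) is listed once, as the permutation     *)
(* with s 0 < s 1, s 2 < s 3, ..., and s 0 < s 2 < s 4 < ...                  *)
Definition is_matching (s : 'S_(2 * n)) : bool :=
  [forall i : 'I_n, (s (even_ord i) < s (odd_ord i))%N] &&
  [forall i : 'I_n, forall j : 'I_n,
     (i < j)%N ==> (s (even_ord i) < s (even_ord j))%N].

Definition pfaffian (A : 'M[R]_(2 * n)) : R :=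
  \sum_(s : 'S_(2 * n) | is_matching s)
     (-1) ^+ s * \prod_(i < n) A (s (even_ord i)) (s (odd_ord i)).

End Pfaffian.

Notation "\pf_ ( i < j < m ) E" :=
  (pfaffian (antisym_mx (fun i j : 'I_m => E)))
  (at level 36, E at level 36, i, j, m at level 50,
   format "\pf_ ( i  <  j  <  m )  E").

(* Main.v *)
Require Import Defs.
From HB Require Import structures.
From mathcomp Require Import all_boot all_order all_fingroup all_algebra.
From mathcomp Require Import mpoly ring zify.

(* If all columns of l have even length then l_(2i-1) = l_(2i), so l is       *)
(* determined by the exponents a_i = l_(2i) + 2n - 2i, and s_l times the      *)
(* Vandermonde product is the alternant with exponents                        *)
(* a_1 + 1, a_1, a_2 + 1, a_2, ... .  These a are the strictly decreasing     *)
(* sequences with gaps at least 2; a gap equal to 1 makes two columns of the  *)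
(* alternant coincide, so one may sum over all strictly decreasing a.  By a   *)
(* de Bruijn type minor summation this sum is the Pfaffian of                 *)
(* (x_i - x_j) sum_e (1 - u t^e) (x_i x_j)^e, a difference of two geometric   *)
(* series.  The minor summation is proved for e < M and up to the factor n!,  *)
(* both sides being averages over the symmetric group on the n pairs; the     *)
(* power series identity follows by letting M grow.                           *)

Set Implicit Arguments.
Unset Strict Implicit.
Unset Printing Implicit Defensive.

Import GRing.Theory Num.Theory.
Local Open Scope ring_scope.

(** * Averaging over the symmetric group *)

(** Let V be the Vandermonde product and put B(i,j) = sum_e f(e) x_i^(e+1) x_j^e. The signed sum
    over all permutations of the products of B over consecutive pairs is evaluated twice.
    Antisymmetrizing inside each pair and then forgetting the order of the pairs gives n! times the
    Pfaffian of B(i,j) - B(j,i), by [sum_perm_pfaffian]. Expanding over the exponents gives a sum of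
    paired alternants, symmetric in the exponents, hence n! times the sum over decreasing ones.
    Comparison yields [pfaffian_sum_decreasing]. For f(e) = 1 - u t^e, the bijection between
    even-column partitions and exponent sequences with gaps at least 2 turns this into
    [bounded_schur_sum_vandermonde], a polynomial identity for each bound M. Schur polynomials are
    homogeneous ([schur_dhomog]), so each coefficient stabilizes as M grows. On the Pfaffian side
    [geometric_series_mul] supplies the closed form of the entries, and dividing by V takes place in
    the fraction field of the power series ring. *)

Section Sorting.
Variable n : nat.
Implicit Types (f : 'I_n -> nat) (s : 'S_n).

Definition increasing f :=
  [forall i : 'I_n, forall j : 'I_n, (i < j)%N ==> (f i < f j)%N].

Lemma increasingP f :
  reflect (forall i j : 'I_n, (i < j)%N -> (f i < f j)%N) (increasing f).
Proof.
apply: (iffP forallP) => [H i j ij|H i].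
  by move/forallP/(_ j)/implyP: (H i); apply.
by apply/forallP => j; apply/implyP/H.
Qed.

Lemma eq_increasing f g : f =1 g -> increasing f = increasing g.
Proof.
by move=> fg; apply: eq_forallb => i; apply: eq_forallb => j; rewrite !fg.
Qed.

Lemma increasing_mono f :
  increasing f -> forall i j : 'I_n, (f i < f j)%N = (i < j)%N.
Proof.
move=> /increasingP H i j; case: (ltngtP i j) => [/H//|/H|/val_inj->].
  by move/ltnW; rewrite leqNgt => /negbTE.
by rewrite ltnn.
Qed.

(** The sorting permutation is the inverse of the rank map, the rank of [i] being the number of
    indices with a smaller value. *)
Lemma exists_unique_sort f : injective f ->
  exists s, forall t : 'S_n, increasing (f \o t) = (t == s).
Proof.
move=> f_inj.
pose rank i := #|[set j | (f j < f i)%N]|.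
have rank_ltn i : (rank i < n)%N.
  rewrite -[X in (_ < X)%N](card_ord n) -cardsT; apply: proper_card.
  by rewrite properT; apply/eqP => /setP /(_ i); rewrite !inE ltnn.
have rank_homo i j : (f i < f j)%N -> (rank i < rank j)%N.
  move=> fij; apply: proper_card; apply/properP; split.
    by apply/subsetP => k; rewrite !inE => /ltn_trans; apply.
  by exists i; rewrite !inE ?ltnn.
pose r i := Ordinal (rank_ltn i).
have r_inj : injective r.
  move=> i j /(congr1 val) /= rij; apply: f_inj.
  by case: (ltngtP (f i) (f j)) => // /rank_homo; rewrite rij ltnn.
exists (perm r_inj)^-1%g => t; apply/idP/eqP => [tincr|->].
  apply: (mulIg (perm r_inj)); rewrite mulVg; apply/permP => i.
  rewrite permM perm1 permE; apply: val_inj; rewrite /= /rank.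
  (* Pulled back along [t], the indices whose value lies below that of [t i] are exactly the
     [j < i]. *)
  rewrite -(card_preimset _ (@perm_inj _ t)) -sum1_card.
  rewrite -[RHS]card_ord -[RHS]sum1_card (big_ord_widen n (fun=> 1%N)) 1?ltnW //.
  by apply: eq_bigl => j; rewrite !inE (increasing_mono tincr).
apply/increasingP => i j ij /=.
have rE k : rank ((perm r_inj)^-1 k)%g = k.
  by rewrite -[RHS](congr1 val (permKV (perm r_inj) k)) permE.
rewrite ltnNge leq_eqVlt; apply/norP; split.
  by apply: contraTneq ij => /f_inj /perm_inj ->; rewrite ltnn.
by apply: contraL ij => /rank_homo; rewrite !rE -leqNgt => /ltnW.
Qed.

(* Every orbit of the [Q]-part under ['S_n] is free, and its points are      *)
(* told apart by the order of their keys; exactly one of them is increasing.  *)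
Lemma sum_increasing_representatives (V : nmodType) (X : finType)
    (act : 'S_n -> X -> X) (key : X -> 'I_n -> nat) (Q : pred X) (G : X -> V) :
    (forall t, bijective (act t)) ->
    (forall t x i, key (act t x) i = key x (t i)) ->
    (forall t x, Q (act t x) = Q x) ->
    (forall t x, Q x -> G (act t x) = G x) ->
    (forall x, Q x -> injective (key x)) ->
  \sum_(x | Q x) G x = (\sum_(x | Q x && increasing (key x)) G x) *+ n`!.
Proof.
move=> act_bij keyE Q_act G_act key_inj.
transitivity (\sum_(t : 'S_n) \sum_(x | Q x && increasing (key (act t x))) G x).
  (* Each [x] is counted for exactly one [t], the one that sorts its key. *)
  rewrite (exchange_big_dep Q) /= => [|t x _ /andP[]//]; apply: eq_bigr => x Qx.
  have [s sE] := exists_unique_sort (key_inj x Qx).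
  rewrite (big_pred1 s) // => t; rewrite /= Qx -sE.
  exact: eq_increasing (keyE t x).
rewrite -card_Sn -sumr_const; apply: eq_bigr => t _.
rewrite [RHS](reindex (act t)) /=; last by apply: onW_bij; exact: act_bij.
apply: eq_big => [x|x /andP[Qx _]]; first by rewrite Q_act.
by rewrite G_act.
Qed.

End Sorting.

(** * Pfaffians and minor summation *)

Section Pairs.
Variable n : nat.

Lemma half_ord_subproof (j : 'I_(2 * n)) : (j./2 < n)%N.
Proof. by rewrite ltn_half_double -mul2n. Qed.

Definition half_ord (j : 'I_(2 * n)) : 'I_n := Ordinal (half_ord_subproof j).

Definition bit_ord (b : bool) (i : 'I_n) := if b then odd_ord i else even_ord i.

Lemma val_bit_ord b i : bit_ord b i = (b + i.*2)%N :> nat.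
Proof. by case: b; rewrite /= mul2n. Qed.

Lemma half_bit b i : half_ord (bit_ord b i) = i.
Proof. by apply: val_inj; rewrite /= val_bit_ord half_bit_double. Qed.

Lemma odd_bit b i : odd (bit_ord b i) = b.
Proof. by rewrite val_bit_ord oddD odd_double addbF oddb. Qed.

Lemma bit_half (j : 'I_(2 * n)) : bit_ord (odd j) (half_ord j) = j.
Proof. by apply: val_inj; rewrite /= val_bit_ord /= odd_double_half. Qed.

Lemma bit_ord_neq b c i j : i != j -> bit_ord b i != bit_ord c j.
Proof. by apply: contra_neq => /(congr1 half_ord); rewrite !half_bit. Qed.

Lemma even_ordE i : even_ord i = bit_ord false i. Proof. by []. Qed.
Lemma odd_ordE i : odd_ord i = bit_ord true i. Proof. by []. Qed.

Lemma big_ord_pairs (T : Type) (idx : T) (op : Monoid.com_law idx)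
    (F : 'I_(2 * n) -> T) :
  \big[op/idx]_(j < 2 * n) F j =
  \big[op/idx]_(i < n) op (F (even_ord i)) (F (odd_ord i)).
Proof.
rewrite (reindex (fun p : 'I_n * bool => bit_ord p.2 p.1)) /=; last first.
  exists (fun j : 'I_(2 * n) => (half_ord j, odd j)) => [[i b] _|j _] /=.
    by rewrite half_bit odd_bit.
  by rewrite bit_half.
rewrite -(pair_bigA _ (fun i b => F (bit_ord b i))) /=.
by apply: eq_bigr => i _; rewrite big_bool /= Monoid.mulmC.
Qed.

Definition bit_act (s : 'S_n) (b : bool) (j : 'I_(2 * n)) :=
  if odd j == b then bit_ord b (s (half_ord j)) else j.

Lemma bit_actE s b c i :
  bit_act s b (bit_ord c i) = bit_ord c (if c == b then s i else i).
Proof. by rewrite /bit_act odd_bit half_bit; case: eqVneq => [->|]. Qed.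

Lemma bit_act_inj s b : injective (bit_act s b).
Proof.
apply: (can_inj (g := bit_act s^-1 b)) => j; rewrite /bit_act.
have [jb|/negPf jb] := eqVneq (odd j) b; last by rewrite jb.
by rewrite odd_bit eqxx half_bit permK -jb bit_half.
Qed.

Lemma flip_involutive :
  involutive (fun j : 'I_(2 * n) => bit_ord (~~ odd j) (half_ord j)).
Proof. by move=> j; rewrite half_bit odd_bit negbK bit_half. Qed.

Definition pair_perm (s : 'S_n) : 'S_(2 * n) :=
  (perm (@bit_act_inj s false) * perm (@bit_act_inj s true))%g.

Lemma pair_permE s b i : pair_perm s (bit_ord b i) = bit_ord b (s i).
Proof.
by rewrite permM !permE bit_actE bit_actE; case: b.
Qed.

(** The actions on even and on odd positions are conjugate under the flip inside each pair, so their
    signs cancel. *)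
Lemma odd_pair_perm s : odd_perm (pair_perm s) = false.
Proof.
pose w := perm (inv_inj flip_involutive).
have -> : pair_perm s = (perm (@bit_act_inj s false) * perm (@bit_act_inj s false) ^ w)%g.
  congr mulg; apply/permP => j; rewrite /conjg !permM.
  have -> : (w^-1 j)%g = w j.
    by apply: (@perm_inj _ w); rewrite permKV !permE flip_involutive.
  rewrite !permE -[in LHS](bit_half j) bit_actE.
  by rewrite -[in RHS](bit_half j) !odd_bit !half_bit bit_actE odd_bit half_bit;
    case: (odd j).
by rewrite odd_permM odd_permJ addbb.
Qed.
End Pairs.

Section Antisymmetrization.
Variables (n : nat) (R : comNzRingType).
Implicit Types (B : 'I_(2 * n) -> 'I_(2 * n) -> R) (s : 'S_(2 * n)).

Definition pair_ascending s (i : 'I_n) := (s (even_ord i) < s (odd_ord i))%N.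

Lemma pfaffianE (a : 'I_(2 * n) -> 'I_(2 * n) -> R) :
  pfaffian (antisym_mx a) =
  \sum_(s | is_matching s) (-1) ^+ s * \prod_(i < n) a (s (even_ord i)) (s (odd_ord i)).
Proof.
apply: eq_bigr => s /andP[/forallP asc _]; congr (_ * _).
by apply: eq_bigr => i _; rewrite mxE asc.
Qed.

(** Exchanging the two entries of a pair changes the sign of the permutation, so descending pairs
    fold onto ascending ones, one pair at a time. *)
Lemma sum_pair_ascending B :
  \sum_s (-1) ^+ odd_perm s * \prod_(i < n) B (s (even_ord i)) (s (odd_ord i)) =
  \sum_(s | [forall i, pair_ascending s i]) (-1) ^+ odd_perm s *
    \prod_(i < n) (B (s (even_ord i)) (s (odd_ord i)) - B (s (odd_ord i)) (s (even_ord i))).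
Proof.
pose E s i := B (s (even_ord i)) (s (odd_ord i)).
pose O s i := B (s (odd_ord i)) (s (even_ord i)).
(* Invariant of the induction: the pairs below [k] are ascending and already carry the
   antisymmetrized factor. *)
pose asc k s := [forall i : 'I_n, (i < k)%N ==> pair_ascending s i].
pose G k s := (-1) ^+ odd_perm s * \prod_(i < n) (if (i < k)%N then E s i - O s i else E s i).
suff H k : (k <= n)%N -> \sum_s (-1) ^+ odd_perm s * \prod_(i < n) E s i = \sum_(s | asc k s) G k s.
  rewrite (H n) //; apply: eq_big => [s|s _].
    by apply: eq_forallb => i; rewrite ltn_ord.
  by congr (_ * _); apply: eq_bigr => i _; rewrite ltn_ord.
elim: k => [_|k IHk k_lt_n].
  by apply: eq_bigl => s; apply/esym/forallP.
rewrite {}IHk 1?ltnW //; pose i0 := Ordinal k_lt_n.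
have ascS s : asc k.+1 s = asc k s && pair_ascending s i0.
  apply/forallP/andP => [H|[/forallP H Hi0] i].
    split; last by have := H i0; rewrite /= ltnSn.
    by apply/forallP => i; apply/implyP => ik; apply: (implyP (H i)); apply: ltnW.
  apply/implyP; rewrite ltnS leq_eqVlt => /predU1P[ik|ik];
    last exact: (implyP (H i)).
  by rewrite (_ : i = i0) //; apply: val_inj.
rewrite (bigID (pair_ascending^~ i0)) /= (eq_bigl _ _ ascS).
pose tr := tperm (even_ord i0) (odd_ord i0).
have eo : even_ord i0 != odd_ord i0 by rewrite -val_eqE /= neq_ltn leqnn.
have trE s i : i != i0 -> ((tr * s)%g (even_ord i) = s (even_ord i)) * ((tr * s)%g (odd_ord i) = s (odd_ord i)).
  move=> ii0; rewrite !permM; split; congr (s _); apply: tpermD;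
  by rewrite ?even_ordE ?odd_ordE bit_ord_neq // eq_sym.
rewrite [X in _ + X](reindex_inj (mulgI tr)) /=.
rewrite [X in _ + X](eq_bigl (fun s => asc k s && pair_ascending s i0)) => [|s];
  last first.
  (* The swap leaves the earlier pairs alone and makes pair [k] ascending, since its two values are
     distinct. *)
  congr andb.
    apply: eq_forallb => i; case: ltnP => //= ik.
    have ii0 : i != i0 by apply: contraTneq ik => ->; rewrite ltnn.
    by rewrite /pair_ascending !trE.
  rewrite /pair_ascending !permM tpermL tpermR -leqNgt leq_eqVlt orb_idl //.
  by move=> /eqP /val_inj /perm_inj /eqP; rewrite (negPf eo).
rewrite -big_split /=; apply: eq_bigr => s _; rewrite /G odd_mul_tperm eo.
rewrite signr_addb mulN1r mulNr -mulrBr; congr (_ * _).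
pose P := \prod_(i < n | i != i0) (if (i < k.+1)%N then E s i - O s i else E s i).
have ltkS i : i != i0 -> (i < k)%N = (i < k.+1)%N.
  by rewrite [in RHS]ltnS [in RHS]leq_eqVlt -val_eqE => /negPf ->.
transitivity (E s i0 * P - O s i0 * P).
  congr (_ - _); rewrite (bigD1 i0) //= ltnn; congr (_ * _).
  - by apply: eq_bigr => i /ltkS ->.
  - by rewrite /E !permM tpermL tpermR.
  - by apply: eq_bigr => i ii0; rewrite ltkS // /E /O !trE.
by rewrite -mulrBl (bigD1 i0) //= ltnSn.
Qed.

(** A permutation with ascending pairs is a matching whose pairs are listed in any of n! orders;
    reordering them by [pair_perm] is even and leaves the term unchanged. The key is the smaller
    entry of each pair. *)
Lemma sum_perm_pfaffian B :
  \sum_s (-1) ^+ odd_perm s * \prod_(i < n) B (s (even_ord i)) (s (odd_ord i)) =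
  pfaffian (antisym_mx (fun i j => B i j - B j i)) *+ n`!.
Proof.
rewrite sum_pair_ascending pfaffianE.
pose act (t : 'S_n) (s : 'S_(2 * n)) := (pair_perm t * s)%g.
pose key (s : 'S_(2 * n)) (i : 'I_n) : nat := s (even_ord i).
have actE t s b i : act t s (bit_ord b i) = s (bit_ord b (t i)).
  by rewrite permM pair_permE.
apply: (sum_increasing_representatives (act := act) (key := key)).
- by move=> t; apply: injF_bij; apply: mulgI.
- by move=> t s i; rewrite /key even_ordE actE.
- move=> t s; apply/forallP/forallP => H i; last first.
    by rewrite /pair_ascending even_ordE odd_ordE !actE; apply: H.
  by have := H ((t^-1)%g i); rewrite /pair_ascending even_ordE odd_ordE !actE permKV.
- move=> t s _; rewrite odd_permM odd_pair_perm /=; congr (_ * _).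
  rewrite [RHS](reindex_inj (@perm_inj _ t)); apply: eq_bigr => i _.
  by rewrite even_ordE odd_ordE !actE.
- move=> s _ i j /val_inj /perm_inj /(congr1 (@half_ord n)).
  by rewrite !even_ordE !half_bit.
Qed.
End Antisymmetrization.

(** * Minor summation for paired exponents *)

Section MinorSummation.
Variables (n M : nat) (R : comNzRingType) (x : 'I_(2 * n) -> R) (f : nat -> R).
Implicit Types (a : {ffun 'I_n -> 'I_M}).

Definition paired_exponent (a : 'I_n -> nat) (j : 'I_(2 * n)) : nat :=
  (a (half_ord j) + ~~ odd j)%N.

Definition paired_alternant (a : 'I_n -> nat) : R :=
  \det (\matrix_(i, j) x i ^+ paired_exponent a j).

(** Reflection in [M] turns decreasing into increasing, the order used for sorting; the subtraction
    never truncates because each [a i] is below [M]. *)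
Definition decreasing (a : {ffun 'I_n -> 'I_M}) := increasing (fun i => M - a i)%N.

Lemma paired_exponentE (a : 'I_n -> nat) b i :
  paired_exponent a (bit_ord b i) = (a i + ~~ b)%N.
Proof. by rewrite /paired_exponent half_bit odd_bit. Qed.

Lemma eq_paired_alternant (a a' : 'I_n -> nat) :
  a =1 a' -> paired_alternant a = paired_alternant a'.
Proof.
by move=> aa'; congr (\det _); apply/matrixP => i j;
  rewrite !mxE /paired_exponent aa'.
Qed.

Lemma paired_alternantE (a : 'I_n -> nat) : paired_alternant a =
  \sum_(s : 'S_(2 * n)) (-1) ^+ odd_perm s *
    \prod_(i < n) (x (s (even_ord i)) ^+ (a i).+1 * x (s (odd_ord i)) ^+ a i).
Proof.
rewrite /paired_alternant -det_tr; apply: eq_bigr => s _; congr (_ * _).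
rewrite big_ord_pairs; apply: eq_bigr => i _; rewrite even_ordE odd_ordE !mxE.
by rewrite !paired_exponentE addn1 addn0.
Qed.

(** Permuting [a] moves whole pairs of columns, which is an even permutation of the columns. *)
Lemma paired_alternant_perm (a : 'I_n -> nat) (t : 'S_n) :
  paired_alternant (a \o t) = paired_alternant a.
Proof.
have det1 : \det (perm_mx (pair_perm t)^-1) = 1 :> R.
  by rewrite det_perm odd_permV odd_pair_perm.
rewrite -[RHS]mulr1 -det1 /paired_alternant -det_mulmx -col_permE.
congr (\det _); apply/matrixP => i j;
  rewrite !mxE -[j in LHS]bit_half -[in RHS](bit_half j).
by rewrite pair_permE !paired_exponentE.
Qed.

Lemma paired_alternant_eq0 (a : 'I_n -> nat) (b c : bool) (i j : 'I_n) : i != j ->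
  (a i + b = a j + c)%N -> paired_alternant a = 0.
Proof.
move=> ij aij; rewrite /paired_alternant -det_tr.
apply: (determinant_alternate (i1 := bit_ord (~~ b) i) (i2 := bit_ord (~~ c) j)).
  exact: bit_ord_neq.
by move=> k; rewrite !mxE !paired_exponentE !negbK aij.
Qed.

Lemma pfaffian_sum_decreasing_fact :
  pfaffian (antisym_mx (fun i j => (x i - x j) * \sum_(e < M) f e * (x i * x j) ^+ e)) *+ n`!
  = (\sum_(a | decreasing a) (\prod_i f (a i)) * paired_alternant (fun i => a i)) *+ n`!.
Proof.
(* Antisymmetrizing this [B] produces the entries of the Pfaffian. *)
pose B i j := \sum_(e < M) f e * (x i ^+ e.+1 * x j ^+ e).
transitivity (pfaffian (antisym_mx (fun i j => B i j - B j i)) *+ n`!).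
  congr (pfaffian _ *+ _); apply/matrixP => i j; rewrite !mxE.
  have BE i' j' : B i' j' - B j' i' = (x i' - x j') * \sum_(e < M) f e * (x i' * x j') ^+ e.
    rewrite /B -sumrB mulr_sumr; apply: eq_bigr => e _.
    by rewrite !exprS exprMn; ring.
  by rewrite !BE.
rewrite -sum_perm_pfaffian.
under eq_bigr => s _ do rewrite bigA_distr_bigA mulr_sumr /=.
rewrite exchange_big /=.
transitivity (\sum_(a : {ffun 'I_n -> 'I_M}) (\prod_i f (a i)) * paired_alternant (fun i => a i)).
  apply: eq_bigr => a _; rewrite paired_alternantE mulr_sumr; apply: eq_bigr => s _.
  by rewrite big_split mulrCA.
(* A repeated exponent gives two equal columns, so only injective [a] survive. *)
rewrite (bigID (fun a : {ffun 'I_n -> 'I_M} => injectiveb a)) /= [X in _ + X]big1 ?addr0; last first.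
  move=> a /injectivePn [i [j ij aij]].
  by rewrite (@paired_alternant_eq0 _ false false i j ij) ?mulr0 // aij.
pose act (t : 'S_n) (a : {ffun 'I_n -> 'I_M}) := [ffun i => a (t i)].
rewrite (sum_increasing_representatives (act := act) (key := fun a i => (M - a i)%N)).
- congr (_ *+ _); apply: eq_bigl => a; apply: andb_idl => adecr.
  apply/injectiveP => i j aij; apply: val_inj.
  by have := increasing_mono adecr i j; have := increasing_mono adecr j i;
    rewrite aij ltnn; case: ltngtP.
- move=> t; apply: injF_bij => a b /ffunP ab; apply/ffunP => i.
  by have := ab (t^-1 i)%g; rewrite !ffunE permKV.
- by move=> t a i; rewrite ffunE.
- move=> t a; apply/injectiveP/injectiveP => a_inj i j.
    move=> aij; apply: (can_inj (permK t^-1)); apply: a_inj.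
    by rewrite !ffunE !permKV.
  by rewrite !ffunE => /a_inj /perm_inj.
- move=> t a _; congr (_ * _).
    rewrite [RHS](reindex_inj (@perm_inj _ t)); apply: eq_bigr => i _.
    by rewrite ffunE.
  rewrite -(paired_alternant_perm (fun i => a i) t);
    apply: eq_paired_alternant => i.
    by rewrite /= ffunE.
- move=> a /injectiveP a_inj i j aij; apply: a_inj; apply: val_inj => /=.
  by have := ltn_ord (a i); have := ltn_ord (a j); move: aij => /=;
    move: (nat_of_ord (a i)) (nat_of_ord (a j)) => k l; lia.
Qed.

Lemma pfaffian_sum_decreasing :
    (forall r s : R, r *+ n`! = s *+ n`! -> r = s) ->
  pfaffian (antisym_mx (fun i j => (x i - x j) * \sum_(e < M) f e * (x i * x j) ^+ e))
  = \sum_(a | decreasing a) (\prod_i f (a i)) * paired_alternant (fun i => a i).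
Proof. by apply; exact: pfaffian_sum_decreasing_fact. Qed.

End MinorSummation.

(** * Partitions with even columns *)

Section Partitions.
Local Open Scope nat_scope.
Implicit Types (l s : seq nat).

Lemma geq_trans : transitive geq.
Proof. by move=> y x z /= xy yz; apply: leq_trans yz xy. Qed.

Lemma sorted_geq_nth l i j : sorted geq l -> i <= j -> nth 0 l j <= nth 0 l i.
Proof.
move=> l_sorted ij; have [jl|jl] := ltnP j (size l); last by rewrite nth_default.
apply: (sorted_leq_nth geq_trans leqnn 0 l_sorted) => //.
exact: leq_ltn_trans jl.
Qed.

(** The zeros of a weakly decreasing list form a tail, and the default value of [nth] restores
    them. *)
Lemma nth_filter_neq0 s j :
  sorted geq s -> nth 0 [seq p <- s | p != 0] j = nth 0 s j.
Proof.
elim: s j => [|p s IHs] j //= /[dup] /path_sorted s_sorted ps.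
have [p0|p_neq0] /= := eqVneq p 0; last by case: j => //= j; rewrite IHs.
rewrite IHs //; have nth0 k : nth 0 (p :: s) k = 0.
  have : nth 0 (p :: s) k <= p := @sorted_geq_nth (p :: s) 0 k ps (leq0n k).
  by rewrite p0 leqn0 => /eqP.
by rewrite [LHS](nth0 j.+1) nth0.
Qed.

(** [count (leq j) l] is the length of column [j], so this is the usual duality between a partition
    and its conjugate, with rows counted from 0. *)
Lemma ltn_count_geq l j k :
  sorted geq l -> 0 < j -> (k < count (leq j) l) = (j <= nth 0 l k).
Proof.
move=> + j_gt0; elim: l k => [|p l IHl] k /=;
  first by rewrite nth_nil ltn0 leqNgt j_gt0.
move=> /[dup] /path_sorted l_sorted pl.
have [jp|pj] := leqP j p; first by case: k => [|k]; rewrite ?add1n ?ltnS ?IHl.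
rewrite add0n IHl // [LHS]leqNgt [RHS]leqNgt; congr negb.
have nth_lt i : nth 0 (p :: l) i < j.
  exact: leq_ltn_trans (@sorted_geq_nth (p :: l) 0 i pl (leq0n i)) pj.
by rewrite nth_lt (nth_lt k.+1).
Qed.

Lemma partn_nth_gt0 l j : is_partn l -> (0 < nth 0 l j) = (j < size l).
Proof.
case/andP=> _ l0; have [jl|jl] := ltnP j (size l); last by rewrite nth_default.
by rewrite lt0n; apply: contraNneq l0 => <-; rewrite mem_nth.
Qed.

Lemma partn_eq_nth l1 l2 : is_partn l1 -> is_partn l2 ->
  (forall j, nth 0 l1 j = nth 0 l2 j) -> l1 = l2.
Proof.
move=> l1P l2P l12; apply: (@eq_from_nth _ 0) => // .
have sz j : (j < size l1) = (j < size l2) by rewrite -!partn_nth_gt0 // l12.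
by apply/eqP; rewrite eqn_leq leqNgt sz ltnn leqNgt -sz ltnn.
Qed.

(** With rows counted from 0, a column of length 2k + 1 exists exactly when rows 2k and 2k + 1
    differ. *)
Lemma all_even_conj_partn l : is_partn l ->
  all (fun c => ~~ odd c) (conj_partn l) <->
  forall k, nth 0 l (2 * k) = nth 0 l (2 * k).+1.
Proof.
case/andP=> l_sorted _; split=> [/allP ev k|eq_l].
  apply/eqP; rewrite eqn_leq [X in _ && X]sorted_geq_nth // andbT leqNgt.
  (* Column [j] reaches row 2k but not row 2k + 1, so its length is odd. *)
  apply/negP => lt_k; pose j := nth 0 l (2 * k).
  have j_gt0 : 0 < j by apply: leq_ltn_trans lt_k.
  have : count (leq j) l \in conj_partn l.
    apply: (map_f (fun i => count (leq i) l)); rewrite mem_iota j_gt0 add1n ltnS.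
    by rewrite -nth0 sorted_geq_nth.
  move/ev; suff -> : count (leq j) l = (2 * k).+1 by rewrite /= oddM.
  apply/eqP; rewrite eqn_leq ltn_count_geq // leqnn andbT leqNgt.
  by rewrite ltn_count_geq // -ltnNge.
apply/allP => c /mapP [j]; rewrite mem_iota => /andP[j_gt0 _] ->.
set c' := count _ _; apply/negP => c_odd.
have [h cE] : exists h, c' = (2 * h).+1.
  by exists c'./2; rewrite mul2n -[LHS]odd_double_half c_odd.
have := ltn_count_geq (2 * h).+1 l_sorted j_gt0.
by rewrite -eq_l -ltn_count_geq // -/c' cE ltnn ltnSn.
Qed.

Lemma nth_leq_sumn l j : nth 0 l j <= sumn l.
Proof.
elim: l j => [|p l IHl] [|j] //=; first exact: leq_addr.
exact: leq_trans (IHl j) (leq_addl _ _).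
Qed.

End Partitions.

(** * Even-column partitions as exponent sequences with gaps at least 2 *)

Section EvenColumns.
Local Open Scope nat_scope.
Variable n : nat.
Implicit Types (l : seq nat) (a : 'I_n -> nat).

Definition even_columns l := [&& is_partn l, size l <= 2 * n
                               & all (fun c => ~~ odd c) (conj_partn l)].

Definition even_part_exponent l (i : 'I_n) := part l (2 * i.+1) + 2 * n - 2 * i.+1.

Definition gap2 a := [forall i : 'I_n, forall j : 'I_n, (i < j) ==> ((a j).+1 < a i)].

(** The common value of rows 2k and 2k + 1, counted from 0. It takes a natural number so that
    [mkseq] can tabulate it, with value 0 out of range. *)
Definition doubled_part a k := oapp (fun i : 'I_n => a i - 2 * (n - k.+1)) 0 (insub k).

Definition partn_of_exponents a : seq nat :=
  [seq p <- mkseq (fun j => doubled_part a j./2) (2 * n) | p != 0].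

Lemma doubled_partE a (i : 'I_n) : doubled_part a i = a i - 2 * (n - i.+1).
Proof. by rewrite /doubled_part valK. Qed.

Lemma gap2P a :
  reflect (forall i j : 'I_n, i < j -> (a j).+1 < a i) (gap2 a).
Proof.
apply: (iffP forallP) => [H i j ij|H i].
  by move/forallP/(_ j)/implyP: (H i); apply.
by apply/forallP => j; apply/implyP/H.
Qed.

(** Downward induction from the last index. It ensures that the subtraction in [doubled_part] never
    truncates. *)
Lemma gap2_lower_bound a (i : 'I_n) : gap2 a -> 2 * (n - i.+1) <= a i.
Proof.
move=> /gap2P aP; have [d dE] : {d | d = n - i.+1} by exists (n - i.+1).
rewrite -dE; elim: d i dE => [//|d IHd] i dE.
have i1 : i.+1 < n by lia.
have := IHd (Ordinal i1); rewrite /= => /(_ ltac:(lia)).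
have := aP i (Ordinal i1) (ltnSn i).
by move: (a i) (a _) => x y; lia.
Qed.

Lemma doubled_part_next a (i j : 'I_n) :
  gap2 a -> i <= j <= i.+1 -> doubled_part a j <= doubled_part a i.
Proof.
move=> aP /andP[]; rewrite leq_eqVlt => /predU1P[/val_inj->//|ij] ji.
rewrite !doubled_partE; have := gap2P _ aP i j ij; have := ltn_ord j.
by move: ij ji; move: (a i) (a j) (i : nat) (j : nat) => x y p q; lia.
Qed.

Lemma doubled_part_sorted a : gap2 a ->
  sorted geq (mkseq (fun j => doubled_part a j./2) (2 * n)).
Proof.
move=> aP; apply/(sortedP 0) => j; rewrite size_mkseq => jn.
rewrite (nth_mkseq _ _ jn) (nth_mkseq _ _ (ltnW jn)).
have jh : j.+1./2 < n by rewrite ltn_half_double -mul2n.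
have jh' : j./2 < n by rewrite ltn_half_double -mul2n ltnW.
apply: (@doubled_part_next a (Ordinal jh') (Ordinal jh)) => //.
by rewrite half_leq //= -[(j./2).+1]/(j.+2./2) (half_leq (leqnSn j.+1)).
Qed.

Lemma nth_partn_of_exponents a (j : 'I_(2 * n)) : gap2 a ->
  nth 0 (partn_of_exponents a) j = a (half_ord j) - 2 * (n - (half_ord j).+1).
Proof.
move=> aP; rewrite nth_filter_neq0 ?doubled_part_sorted // nth_mkseq //.
by rewrite -doubled_partE.
Qed.

Lemma partn_of_exponents_is_partn a : gap2 a -> is_partn (partn_of_exponents a).
Proof.
move=> aP; rewrite /is_partn mem_filter eqxx andbT.
by apply: sorted_filter (doubled_part_sorted aP); apply: geq_trans.
Qed.

Lemma size_partn_of_exponents a : size (partn_of_exponents a) <= 2 * n.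
Proof. by rewrite size_filter (leq_trans (count_size _ _)) ?size_mkseq. Qed.

Lemma partn_of_exponents_even_columns a :
  gap2 a -> even_columns (partn_of_exponents a).
Proof.
move=> aP; have lP := partn_of_exponents_is_partn aP.
rewrite /even_columns lP size_partn_of_exponents /=.
apply/all_even_conj_partn => // k; have [kn|nk] := ltnP k n; last first.
  by rewrite !nth_default // (leq_trans (size_partn_of_exponents a)) //; lia.
rewrite -[k]/(val (Ordinal kn)) -[2 * _]/(val (even_ord (Ordinal kn))).
rewrite -[(val (even_ord _)).+1]/(val (odd_ord (Ordinal kn))) !nth_partn_of_exponents //.
by rewrite even_ordE odd_ordE !half_bit.
Qed.

Lemma even_columns_nth l (j : 'I_(2 * n)) : even_columns l ->
  nth 0 l j = nth 0 l (2 * half_ord j).+1.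
Proof.
case/and3P=> lP _ /(all_even_conj_partn lP) lE.
rewrite -[j in LHS]bit_half val_bit_ord -mul2n.
by case: (odd j); rewrite // -lE.
Qed.

Lemma even_part_exponentE l (i : 'I_n) :
  even_part_exponent l i = nth 0 l (2 * i).+1 + 2 * (n - i.+1).
Proof.
rewrite /even_part_exponent /part (_ : (2 * i.+1).-1 = (2 * i).+1); last by lia.
by rewrite -addnBA ?mulnBr // leq_mul2l ltn_ord.
Qed.

Lemma gap2_even_part_exponent l : even_columns l -> gap2 (even_part_exponent l).
Proof.
case/and3P=> lP _ _.
apply/gap2P => i j ij; rewrite !even_part_exponentE.
have ln : nth 0 l (2 * j).+1 <= nth 0 l (2 * i).+1.
  by case/andP: lP => l_sorted _; rewrite sorted_geq_nth //; lia.
by have := ltn_ord j; move: ij ln; move: (nth 0 l _) (nth 0 l _) => p q; lia.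
Qed.

Lemma even_part_exponentK l :
  even_columns l -> partn_of_exponents (even_part_exponent l) = l.
Proof.
move=> lC; have /and3P[lP l_size _] := lC.
have aP := gap2_even_part_exponent lC.
apply: partn_eq_nth => // [|j]; first exact: partn_of_exponents_is_partn.
have [jn|nj] := ltnP j (2 * n); last first.
  by rewrite !nth_default // ?(leq_trans l_size) // (leq_trans (size_partn_of_exponents _)).
rewrite -[j]/(val (Ordinal jn)) nth_partn_of_exponents // even_part_exponentE.
by rewrite addnK -even_columns_nth.
Qed.

Lemma partn_of_exponentsK a : gap2 a ->
  even_part_exponent (partn_of_exponents a) =1 a.
Proof.
move=> aP i; rewrite even_part_exponentE -[(2 * i).+1]/(val (odd_ord i)).
rewrite nth_partn_of_exponents // odd_ordE half_bit subnK //.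
exact: gap2_lower_bound.
Qed.

(** Adding the staircase to two equal rows makes their exponents consecutive. *)
Lemma schur_exponentE l (j : 'I_(2 * n)) : even_columns l ->
  part l j.+1 + (2 * n - j.+1) = paired_exponent (even_part_exponent l) j.
Proof.
move=> lC; rewrite /part /= even_columns_nth //.
rewrite /paired_exponent even_part_exponentE -addnA; congr (_ + _).
rewrite -[j in LHS]bit_half val_bit_ord; have := ltn_ord (half_ord j).
by move: (half_ord j : nat) (odd j) => k []; lia.
Qed.

Lemma even_part_exponent_lt l i : even_columns l ->
  even_part_exponent l i < sumn l + 2 * n.
Proof.
move=> lC; rewrite even_part_exponentE; have := nth_leq_sumn l (2 * i).+1.
by have := ltn_ord i; lia.
Qed.

Variable M : nat.

Definition bounded_partns : seq (seq nat) :=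
  [seq partn_of_exponents (fun i => a i) |
     a : {ffun 'I_n -> 'I_M} <- enum [pred a : {ffun 'I_n -> 'I_M} | gap2 (fun i => a i)]].

Lemma bounded_partns_uniq : uniq bounded_partns.
Proof.
rewrite map_inj_in_uniq ?enum_uniq // => a b; rewrite !mem_enum !inE => aP bP ab.
apply/ffunP => i; apply: val_inj.
by rewrite /= -(partn_of_exponentsK aP) ab partn_of_exponentsK.
Qed.

Lemma bounded_partns_even_columns : all even_columns bounded_partns.
Proof.
apply/allP => l /mapP[a]; rewrite mem_enum inE => aP ->.
exact: partn_of_exponents_even_columns.
Qed.

(** Every part is at most the size of the partition, so bounding the size bounds the exponents. *)
Lemma mem_bounded_partns l :
  even_columns l -> sumn l + 2 * n <= M -> l \in bounded_partns.
Proof.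
move=> lC lM; pose a := [ffun i => Ordinal (leq_trans (even_part_exponent_lt i lC) lM)].
have aE : even_part_exponent l =1 (fun i => a i) by move=> i; rewrite ffunE.
apply/mapP; exists a.
  rewrite mem_enum inE; apply/gap2P => i j ij; rewrite -!aE.
  exact: (gap2P _ (gap2_even_part_exponent lC)).
rewrite -[LHS](even_part_exponentK lC).
rewrite /partn_of_exponents; congr [seq p <- _ | _]; apply: eq_mkseq => j.
by rewrite /doubled_part; case: insub => //= i; rewrite aE.
Qed.

End EvenColumns.

(** * Homogeneity of Schur polynomials *)

Section Homogeneity.
Variables (N : nat) (R : idomainType).
Implicit Types (p q r : {mpoly R[N]}).

Lemma dhomog_big_prod (I : finType) (P : pred I) (F : I -> {mpoly R[N]}) (d : I -> nat) :
  (forall i, P i -> F i \is (d i).-homog) ->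
  \prod_(i | P i) F i \is (\sum_(i | P i) d i)%N.-homog.
Proof.
move=> FP; elim/big_rec2: _ => [|i e p Pi pe]; first exact: dhomog1.
exact: dhomogM (FP i Pi) pe.
Qed.

Lemma pihomogMr c e p q : q \is e.-homog ->
  pihomog mdeg (c + e) (p * q) = pihomog mdeg c p * q.
Proof.
move=> qe; pose k := maxn (mmeasure mdeg p) c.+1.
rewrite {1}(pihomog_partitionE (leq_maxl _ _ : (mmeasure mdeg p <= k)%N)).
rewrite mulr_suml linear_sum /=.
have ck : (c < k)%N by exact: leq_maxr.
rewrite (bigD1 (Ordinal ck)) //= big1 ?addr0 => [|i ic].
  by rewrite pihomog_dE // dhomogM // pihomogP.
apply: (@pihomog_ne0 _ _ _ (i + e)%N); last by rewrite dhomogM // pihomogP.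
by rewrite eqn_add2r; apply: contraNneq ic => ic; apply/eqP/val_inj.
Qed.

(** A component of [p] in a degree other than [d], times [q], is a vanishing component of [p * q];
    then [q] cancels. *)
Lemma dhomog_quotient d e p q : q != 0 -> q \is e.-homog ->
  p * q \is (d + e)%N.-homog -> p \is d.-homog.
Proof.
move=> q0 qe pqde; rewrite (pihomog_partitionE (leqnn (mmeasure mdeg p))).
apply: rpred_sum => c _; have [->|cd] := eqVneq (c : nat) d; first exact: pihomogP.
suff -> : pihomog mdeg c p = 0 by rewrite rpred0.
apply/eqP; rewrite -(mulIr_eq0 _ (mulIf q0)) -(pihomogMr _ _ qe); apply/eqP.
by apply: pihomog_ne0 pqde; rewrite eqn_add2r eq_sym.
Qed.

Lemma alternant_dhomog (a : 'I_N -> nat) :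
  alternant R a \is (\sum_j a j)%N.-homog.
Proof.
apply: rpred_sum => s _; rewrite mulr_sign.
suff H : \prod_i (\matrix_(i, j) ('X_i : {mpoly R[N]}) ^+ a j) i (s i) \is (\sum_j a j)%N.-homog.
  by case: (odd_perm s); rewrite ?rpredN.
rewrite [X in X.-homog](reindex_inj (@perm_inj _ s)); apply: dhomog_big_prod => i _.
rewrite mxE -[X in X.-homog]mul1n; apply: dhomogMn.
by rewrite dhomogX /= mdeg1.
Qed.

Lemma sum_gt_ord (i : 'I_N) : (\sum_(j < N | i < j) 1 = N - i.+1)%N.
Proof.
rewrite -(big_mkord (fun j => i < j)%N (fun=> 1%N)).
rewrite (big_cat_nat (n := i.+1)) //= big_nat_cond big1 ?add0n; last by move=> j;
  lia.
rewrite big_nat_cond (eq_bigl (fun j => (i < j < N)%N)); last by move=> j; lia.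
by rewrite -big_nat sum_nat_const_nat muln1.
Qed.

Lemma vandermonde_prod_dhomog :
  vandermonde_prod N R \is (\sum_(i < N) (N - i.+1))%N.-homog.
Proof.
apply: dhomog_big_prod => i _; rewrite -sum_gt_ord; apply: dhomog_big_prod => j _.
by rewrite rpredB // dhomogX /= mdeg1.
Qed.

Lemma vandermonde_prod_neq0 : vandermonde_prod N R != 0.
Proof.
apply/prodf_neq0 => i _; apply/prodf_neq0 => j ij.
rewrite subr_eq0; apply/eqP => /(congr1 (mcoeff U_(i))) /eqP.
rewrite !mcoeffXU eqxx; have [ji|_] := eqVneq j i; last by rewrite oner_eq0.
by rewrite ji ltnn in ij.
Qed.

(** A quotient of homogeneous polynomials: the staircase part of the exponents accounts for the
    degree of the Vandermonde product. *)
Lemma schur_dhomog (l : seq nat) : (size l <= N)%N -> schur N R l \is (sumn l).-homog.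
Proof.
move=> lN; apply: (dhomog_quotient vandermonde_prod_neq0 vandermonde_prod_dhomog).
rewrite schurE (_ : sumn l = \sum_(j < N) part l j.+1)%N.
  by rewrite -big_split; apply: alternant_dhomog.
rewrite sumnE (big_nth 0%N) big_mkord (big_ord_widen N (fun i => nth 0 l i)%N) //.
rewrite [RHS](bigID (fun j : 'I_N => j < size l)%N) /= [X in (_ + X)%N]big1 ?addn0 // => j.
by rewrite -leqNgt /part /= => /(nth_default 0%N).
Qed.

End Homogeneity.

(** * Power series modulo a degree *)

Section Approximation.
Variables (N : nat) (R : comNzRingType).
Implicit Types (f g h : {fps R[N]}) (p q : {mpoly R[N]}) (m : 'X_{1..N}).

Lemma fps_of_mpoly_is_zmod_morphism : zmod_morphism (@fps_of_mpoly N R).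
Proof. by move=> p q; apply: fpsP => m; rewrite /= mcoeffB. Qed.

Lemma fps_of_mpoly_is_monoid_morphism : monoid_morphism (@fps_of_mpoly N R).
Proof.
split=> // p q; apply: fpsP => m.
by rewrite fcoefM /= mcoeffM.
Qed.

HB.instance Definition _ := GRing.isZmodMorphism.Build _ _ (@fps_of_mpoly N R)
  fps_of_mpoly_is_zmod_morphism.
HB.instance Definition _ := GRing.isMonoidMorphism.Build _ _ (@fps_of_mpoly N R)
  fps_of_mpoly_is_monoid_morphism.

Lemma fps_of_mpoly_inj : injective (@fps_of_mpoly N R).
Proof. by move=> p q /(congr1 (@fcoef _ _)) pq; apply/mpolyP => m;
  have := congr1 (@^~ m) pq. Qed.

Definition fps_eq k f g := forall m, (mdeg m < k)%N -> fcoef f m = fcoef g m.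

Lemma fps_eq_refl k f : fps_eq k f f. Proof. by []. Qed.

Lemma fps_eq_sym k f g : fps_eq k f g -> fps_eq k g f.
Proof. by move=> fg m mk; rewrite fg. Qed.

Lemma fps_eq_trans k f g h : fps_eq k f g -> fps_eq k g h -> fps_eq k f h.
Proof. by move=> fg gh m mk; rewrite fg ?gh. Qed.

Lemma fps_eqW k k' f g : (k <= k')%N -> fps_eq k' f g -> fps_eq k f g.
Proof. by move=> kk' fg m mk; rewrite fg // (leq_trans mk). Qed.

Lemma fps_eqD k f f' g g' :
  fps_eq k f f' -> fps_eq k g g' -> fps_eq k (f + g) (f' + g').
Proof. by move=> ff' gg' m mk /=; rewrite ff' ?gg'. Qed.

Lemma fps_eqM k f f' g g' :
  fps_eq k f f' -> fps_eq k g g' -> fps_eq k (f * g) (f' * g').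
Proof.
move=> ff' gg' m mk; rewrite !fcoefM; apply: eq_bigr => -[k1 k2] _ /=.
by rewrite ff' ?gg' // (leq_trans (bmdeg _)).
Qed.

Lemma fps_eq_prod k (I : finType) (P : pred I) (F G : I -> {fps R[N]}) :
  (forall i, P i -> fps_eq k (F i) (G i)) ->
  fps_eq k (\prod_(i | P i) F i) (\prod_(i | P i) G i).
Proof.
move=> FG; elim/big_rec2: _ => // i f g Pi fg.
exact: fps_eqM (FG i Pi) fg.
Qed.

Lemma fps_eq_sum k (I : finType) (P : pred I) (F G : I -> {fps R[N]}) :
  (forall i, P i -> fps_eq k (F i) (G i)) ->
  fps_eq k (\sum_(i | P i) F i) (\sum_(i | P i) G i).
Proof.
move=> FG; elim/big_rec2: _ => // i f g Pi fg.
exact: fps_eqD (FG i Pi) fg.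
Qed.

Lemma fps_eq_limit f g : (forall k, fps_eq k f g) -> f = g.
Proof. by move=> fg; apply: fpsP => m; apply: (fg (mdeg m).+1). Qed.

(** A genuine limit when all [P k'] with [k <= k'] agree below degree [k]: the coefficient of [m] is
    then settled at stage [(mdeg m).+1]. *)
Definition fps_limit (P : nat -> {mpoly R[N]}) : {fps R[N]} :=
  Fps (fun m => (P (mdeg m).+1)@_m).

End Approximation.

(** Two geometric series, of ratios [y] and [t * y], with denominators cleared; the last summand is
    the tail, a multiple of [y ^+ k]. *)
Lemma sum_geometric_difference (A : comNzRingType) (t u y : A) k :
  (\sum_(e < k) (1 - u * t ^+ e) * y ^+ e) * ((1 - y) * (1 - t * y)) =
  1 - u + (u - t) * y + y ^+ k * (u * t ^+ k * (1 - y) - (1 - t * y)).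
Proof.
have -> : \sum_(e < k) (1 - u * t ^+ e) * y ^+ e =
    \sum_(e < k) y ^+ e - u * \sum_(e < k) (t * y) ^+ e.
  by rewrite mulr_sumr -sumrB; apply: eq_bigr => e _; rewrite exprMn; ring.
have geom (z : A) : (\sum_(e < k) z ^+ e) * (1 - z) = 1 - z ^+ k.
  by rewrite -[RHS]opprB subrX1; ring.
transitivity ((1 - y ^+ k) * (1 - t * y) - u * (1 - (t * y) ^+ k) * (1 - y)).
  by rewrite -!geom; ring.
by rewrite exprMn; ring.
Qed.

(** Lets n! be cancelled in iterated polynomial rings, starting from the integers. *)
Lemma mpoly_natmul_inj N (R : nzRingType) k :
  (forall r s : R, r *+ k = s *+ k -> r = s) ->
  forall p q : {mpoly R[N]}, p *+ k = q *+ k -> p = q.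
Proof.
move=> H p q pq; apply/mpolyP => m; apply: H.
by rewrite -!mcoeffMn pq.
Qed.

(** * The weighted Schur sum: polynomial identity and passage to the limit *)

Section WeightedSchurSum.
Variables (n : nat) (R : idomainType) (t u : R).
Hypothesis fact_inj : forall r s : R, r *+ n`! = s *+ n`! -> r = s.

Let P := {mpoly R[2 * n]}.

Definition weight (e : nat) : R := 1 - u * t ^+ e.

Definition weighted_schur (l : seq nat) : P :=
  (\prod_(1 <= i < n.+1) (1 - u * t ^+ (part l (2 * i) + 2 * n - 2 * i)))
    *: schur (2 * n) R l.

Definition bounded_schur_sum M : P := \sum_(l <- bounded_partns n M) weighted_schur l.

Definition geometric_poly (i j : 'I_(2 * n)) M : P :=
  \sum_(e < M) (weight e)%:MP * ('X_i * 'X_j) ^+ e.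

Lemma weighted_schur_vandermonde l : even_columns n l ->
  weighted_schur l * vandermonde_prod (2 * n) R =
  (\prod_(i < n) (weight (even_part_exponent l i))%:MP) *
    paired_alternant (fun i => 'X_i : P) (@even_part_exponent n l).
Proof.
move=> lC; rewrite /weighted_schur -scalerAl schurE -mul_mpolyC; congr (_ * _).
  by rewrite big_add1 big_mkord rmorph_prod.
congr (\det _); apply/matrixP => i j; rewrite !mxE.
by rewrite schur_exponentE.
Qed.

(** Minor summation with these weights: decreasing exponents with a gap of 1 contribute nothing, and
    the others correspond to the listed partitions. *)
Lemma bounded_schur_sum_vandermonde M :
  bounded_schur_sum M * vandermonde_prod (2 * n) R =
  pfaffian (antisym_mx (fun i j => ('X_i - 'X_j) * geometric_poly i j M)).
Proof.
rewrite (@pfaffian_sum_decreasing _ _ _ (fun i => 'X_i) (fun e => (weight e)%:MP)); last first.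
  exact: mpoly_natmul_inj.
rewrite mulr_suml /bounded_partns big_map big_enum /=.
rewrite [RHS](bigID (fun a : {ffun 'I_n -> 'I_M} => gap2 (fun i => a i))) /=.
rewrite [X in _ + X]big1 ?addr0 => [|a /andP[adecr]]; last first.
  case/forallPn => i /forallPn [j]; rewrite negb_imply -leqNgt => /andP[ij aij].
  have aji := increasingP _ adecr i j ij.
  (* Here [a i] equals [a j] plus 1, so the second column of pair [i] coincides with the first
     column of pair [j]. *)
  rewrite (@paired_alternant_eq0 _ _ _ _ false true i j) ?mulr0 //.
    by rewrite neq_ltn ij.
  by move: aij aji (ltn_ord (a i)) => /=; move: (a i : nat) (a j : nat) => p q; lia.
apply: eq_big => [a|a aP].
  rewrite inE; apply/esym/andb_idl => /gap2P aP; apply/increasingP => i j ij.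
  by have := aP i j ij; have := ltn_ord (a i);
    move: (a i : nat) (a j : nat) => p q; lia.
rewrite (weighted_schur_vandermonde (partn_of_exponents_even_columns aP)).
congr (_ * _).
  by apply: eq_bigr => i _; rewrite (partn_of_exponentsK aP).
by apply: eq_paired_alternant; apply: partn_of_exponentsK.
Qed.

Lemma fcoef_weighted_schur l m : even_columns n l -> sumn l != mdeg m ->
  fcoef (fps_of_mpoly (weighted_schur l)) m = 0.
Proof.
case/and3P=> _ ln _ lm; apply: (@dhomog_nemf_coeff _ _ mdeg (sumn l));
  last by rewrite eq_sym.
by apply: rpredZ; apply: schur_dhomog.
Qed.

(** By homogeneity only partitions of size [mdeg m] reach the coefficient of [m], and these are all
    listed at the bound [K m + 2 * n]. The cut-off [K] is left free so that different truncations
    can be compared. *)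
Lemma is_fps_sum_bounded (K : 'X_{1..2 * n} -> nat) : (forall m, mdeg m < K m)%N ->
  is_fps_sum (even_columns n) (fun l => fps_of_mpoly (weighted_schur l))
    (Fps (fun m => (bounded_schur_sum (K m + 2 * n))@_m)).
Proof.
move=> mK m; exists (bounded_partns n (K m + 2 * n)); split.
- exact: bounded_partns_uniq.
- exact: bounded_partns_even_columns.
- move=> l lC ln; apply: fcoef_weighted_schur => //.
  apply: contraNneq ln => lm; apply: mem_bounded_partns => //.
  by rewrite lm leq_add2r ltnW.
- by rewrite /= raddf_sum.
Qed.

Definition schur_series : {fps R[2 * n]} :=
  fps_limit (fun k => bounded_schur_sum (k + 2 * n)).

Lemma is_fps_sum_schur_series :
  is_fps_sum (even_columns n) (fun l => fps_of_mpoly (weighted_schur l)) schur_series.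
Proof. exact: is_fps_sum_bounded. Qed.

Lemma schur_series_approx k :
  fps_eq k schur_series (fps_of_mpoly (bounded_schur_sum (k + 2 * n))).
Proof.
(* Truncating at any [K m > mdeg m] yields a sum of the same family; choosing *)
(* [K m = k] below degree [k] gives the claim by uniqueness of the sum.       *)
move=> m mk; pose K (m' : 'X_{1..2 * n}) := maxn k (mdeg m').+1.
have sumK := @is_fps_sum_bounded K (fun m' => leq_maxr k (mdeg m').+1).
rewrite (fps_sum_uniq is_fps_sum_schur_series sumK) /= /K.
by rewrite (maxn_idPl mk).
Qed.

Definition geometric_series i j : {fps R[2 * n]} := fps_limit (geometric_poly i j).

Lemma mulXX_exp (i j : 'I_(2 * n)) e :
  ('X_i * 'X_j) ^+ e = 'X_[(U_(i) + U_(j)) *+ e] :> P.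
Proof. by rewrite -mpolyXD mpolyXn. Qed.

Lemma mcoeff_mulXX_exp (i j : 'I_(2 * n)) e m : (mdeg m < e)%N ->
  (('X_i * 'X_j : P) ^+ e)@_m = 0.
Proof.
move=> me; rewrite mulXX_exp mcoeffX; case: eqP => // mE; move: me.
by rewrite -mE mdegMn mdegD !mdeg1; lia.
Qed.

Lemma geometric_series_approx i j k :
  fps_eq k (geometric_series i j) (fps_of_mpoly (geometric_poly i j k)).
Proof.
move=> m mk /=; rewrite /geometric_poly.
rewrite (big_ord_widen k (fun e => (weight e)%:MP * ('X_i * 'X_j) ^+ e)) //.
rewrite [in RHS](bigID (fun e : 'I_k => (e < (mdeg m).+1)%N)) /= mcoeffD.
rewrite [X in _ + X](_ : _ = 0) ?addr0 // raddf_sum big1 // => e.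
by rewrite -leqNgt => me; rewrite /= mcoeffCM mcoeff_mulXX_exp ?mulr0.
Qed.

Lemma geometric_poly_mul i j k :
  let y : P := 'X_i * 'X_j in
  geometric_poly i j k * ((1 - y) * (1 - t%:MP * y)) =
  1 - u%:MP + (u%:MP - t%:MP) * y
  + y ^+ k * (u%:MP * t%:MP ^+ k * (1 - y) - (1 - t%:MP * y)).
Proof.
move=> y; rewrite -sum_geometric_difference; congr (_ * _); apply: eq_bigr => e _.
by rewrite /weight mpolyCB mpolyC1 mpolyCM rmorphXn.
Qed.

(** Modulo degree [k] the series is its truncation, whose error term is a multiple of [y ^+ k] and
    hence vanishes there. *)
Lemma geometric_series_mul i j :
  let y : P := 'X_i * 'X_j in
  geometric_series i j * fps_of_mpoly ((1 - y) * (1 - t%:MP * y)) =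
  fps_of_mpoly (1 - u%:MP + (u%:MP - t%:MP) * y).
Proof.
move=> y; apply: fps_eq_limit => k.
apply: fps_eq_trans (fps_eqM (@geometric_series_approx i j k) (@fps_eq_refl _ _ _ _)) _.
rewrite -rmorphM /= geometric_poly_mul rmorphD rmorphM /= -[X in fps_eq _ _ X]addr0.
apply: fps_eqD; first exact: fps_eq_refl.
rewrite -[X in fps_eq _ _ X](mul0r (fps_of_mpoly (u%:MP * t%:MP ^+ k * (1 - y) - (1 - t%:MP * y)))).
apply: fps_eqM => [m mk|]; last exact: fps_eq_refl.
by rewrite fcoef0 /= mcoeff_mulXX_exp.
Qed.

(** Modulo degree [k] both sides agree with the polynomial identity at the bound [k + 2 * n]. *)
Lemma schur_series_vandermonde :
  schur_series * fps_of_mpoly (vandermonde_prod (2 * n) R) =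
  pfaffian (antisym_mx (fun i j =>
    fps_of_mpoly ('X_i - 'X_j) * geometric_series i j)).
Proof.
apply: fps_eq_limit => k.
apply: fps_eq_trans (fps_eqM (@schur_series_approx k) (@fps_eq_refl _ _ _ _)) _.
rewrite -rmorphM /= bounded_schur_sum_vandermonde !pfaffianE rmorph_sum /=.
apply: fps_eq_sum => s _; rewrite rmorphM rmorph_sign rmorph_prod /=.
apply: fps_eqM; first exact: fps_eq_refl.
apply: fps_eq_prod => i _; rewrite rmorphM /=; apply: fps_eqM;
  first exact: fps_eq_refl.
apply: fps_eqW (leq_addr (2 * n) k) _; apply: fps_eq_sym.
exact: geometric_series_approx.
Qed.

Lemma tofrac_schur_series :
  let inK (p : P) : {fraction {fps R[2 * n]}} := tofrac (fps_of_mpoly p) in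
  let tK := inK t%:MP in
  let uK := inK u%:MP in
  let x (i : 'I_(2 * n)) := inK 'X_i in
  tofrac schur_series =
  (\prod_(i < 2 * n) \prod_(j < 2 * n | (i < j)%N) (1 / (x i - x j)))
    * \pf_(i < j < 2 * n)
        (((x i - x j) * (1 - uK + (uK - tK) * x i * x j))
         / ((1 - x i * x j) * (1 - tK * x i * x j))).
Proof.
move=> inK tK uK x.
have inK_eq0 p : inK p = 0 -> p = 0.
  move=> /eqP; rewrite tofrac_eq0 => /eqP p0; apply: fps_of_mpoly_inj.
  by rewrite p0 rmorph0.
have inKB p q : inK (p - q) = inK p - inK q by rewrite /inK !rmorphB.
have inKM p q : inK (p * q) = inK p * inK q by rewrite /inK !rmorphM.
have inK1 : inK 1 = 1 by rewrite /inK !rmorph1.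
have inKD p q : inK (p + q) = inK p + inK q by rewrite /inK !rmorphD.
(* Each factor has constant term 1, hence is nonzero. *)
have denom_neq0 i j : (1 - x i * x j) * (1 - tK * x i * x j) != 0.
  have XX0 : ('X_i * 'X_j : P)@_0%MM = 0.
    rewrite -mpolyXD mcoeffX; case: eqP => // /(congr1 mdeg).
    by rewrite mdegD !mdeg1 mdeg0.
  rewrite mulf_neq0 //; apply/eqP;
    rewrite /x /tK -?mulrA -!inKM -inK1 -inKB => /inK_eq0.
    move/(congr1 (mcoeff 0%MM))/eqP; rewrite mcoeffB XX0 mcoeff1 eqxx mcoeff0 subr0.
    by rewrite oner_eq0.
  move/(congr1 (mcoeff 0%MM))/eqP;
    rewrite mcoeffB mcoeffCM XX0 mcoeff1 eqxx mcoeff0.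
  by rewrite mulr0 subr0 oner_eq0.
have entryE i j : tofrac (geometric_series i j) =
    (1 - uK + (uK - tK) * x i * x j) / ((1 - x i * x j) * (1 - tK * x i * x j)).
  apply: (mulIf (denom_neq0 i j)); rewrite mulfVK //.
  have : tofrac (geometric_series i j) *
      inK ((1 - 'X_i * 'X_j) * (1 - t%:MP * ('X_i * 'X_j))) =
      inK (1 - u%:MP + (u%:MP - t%:MP) * ('X_i * 'X_j)).
    by rewrite /inK -rmorphM geometric_series_mul.
  by rewrite inKD !(inKM, inKB) inK1 !mulrA.
have prodE : \prod_(i < 2 * n) \prod_(j < 2 * n | (i < j)%N) (1 / (x i - x j)) =
    (inK (vandermonde_prod (2 * n) R))^-1.
  rewrite /inK /vandermonde_prod !rmorph_prod -prodfV; apply: eq_bigr => i _ /=.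
  rewrite !rmorph_prod -prodfV; apply: eq_bigr => j _ /=.
  by rewrite div1r -/(inK _) inKB.
have V0 : inK (vandermonde_prod (2 * n) R) != 0.
  by apply/eqP => /inK_eq0/eqP; apply/negP/vandermonde_prod_neq0.
(* Clearing the Vandermonde product reduces the claim to the power series identity, compared
   matching by matching. *)
rewrite prodE; apply: (mulfI V0); rewrite mulVKf // mulrC -rmorphM /=.
rewrite schur_series_vandermonde !pfaffianE rmorph_sum /=.
apply: eq_bigr => s _; rewrite rmorphM rmorph_sign rmorph_prod /=; congr (_ * _).
apply: eq_bigr => i _; rewrite rmorphM /= entryE -/(inK _) inKB -!/(x _).
by rewrite mulrA.
Qed.

End WeightedSchurSum.

(* MathComp world. *)
Theorem theorem6 (n : nat) :
  let Ztu := {mpoly int[2]} in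
  let t : Ztu := 'X_0 in
  let u : Ztu := 'X_1 in
  let inK (p : {mpoly Ztu[2 * n]}) : {fraction {fps Ztu[2 * n]}} :=
    tofrac (fps_of_mpoly p) in
  let tK := inK t%:MP in
  let uK := inK u%:MP in
  let x (i : 'I_(2 * n)) := inK 'X_i in
  exists S : {fps Ztu[2 * n]},
    is_fps_sum
      (fun l : seq nat =>
         [&& is_partn l, (size l <= 2 * n)%N
           & all (fun c => ~~ odd c) (conj_partn l)])
      (fun l : seq nat => fps_of_mpoly
         ((\prod_(1 <= i < n.+1)
              (1 - u * t ^+ (part l (2 * i) + 2 * n - 2 * i)))
          *: schur (2 * n) Ztu l))
      S
    /\
    tofrac S =
      (\prod_(i < 2 * n) \prod_(j < 2 * n | (i < j)%N) (1 / (x i - x j)))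
      * \pf_(i < j < 2 * n)
          (((x i - x j) * (1 - uK + (uK - tK) * x i * x j))
           / ((1 - x i * x j) * (1 - tK * x i * x j))).
Proof.
(* Polynomials over the integers are torsion-free, so n! may be cancelled. *)
have fact_inj (r s : {mpoly int[2]}) : r *+ n`! = s *+ n`! -> r = s.
  apply: mpoly_natmul_inj => a b /eqP.
  by rewrite eqr_pMn2r ?fact_gt0 // => /eqP.
exists (schur_series n 'X_0 'X_1); split; first exact: is_fps_sum_schur_series.
exact: tofrac_schur_series.
Qed.
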